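(* For every even integer $k\ge 2$ there exists a bipartite graph $G=(V_1\cup V_2,E)$ with $4.5k$ vertices such that none of Rules 1, 2 and 3 applies to $G$ and the minimum cost of a biclustering of $G$ is exactly $k$.
   Context: $N(x)$ denotes the neighborhood of $x$; for a set $X$ of vertices on one side, $N(X)=\bigcup_{x\in X}N(x)$. Two vertices on the same side are twins if they have the same neighborhood; a twin class is an equivalence class of this relation (possibly a single vertex). Given a twin class $R$ with $S=N(R)$, a vertex $t\in N(S)\setminus R$ is a sister of $R$ if $t$ has no twin in $G$ and $N(t)=S\cup\{v\}$ for some vertex $v\notin S$. A bicluster is a set $X\cup Y$ with $X\subseteq V_1$, $Y\subseteq V_2$ such that $N(x)=Y$ for all $x\in X$ and $N(y)=X$ for all $y\in Y$ (an isolated vertex is a bicluster); a bicluster graph is a graph each of whose connected components is a bicluster. A biclustering of $G$ is a bicluster graph $\mathcal{B}$ with $V(\mathcal{B})=V(G)$ all of whose edges go between $V_1$ and $V_2$; its cost is $|E(G)\triangle E(\mathcal{B})|$. Rule 1 applies if some connected component of $G$ is a bicluster. Rule 2 applies if there is a twin class $R$ with $|R|>|N(N(R))\setminus R|$. Rule 3 applies if there is a twin class $R$ such that, with $T$ the set of sisters of $R$ and $W=N(N(R))\setminus(R\cup T)$, we have $|R|>|W|$ and $|T|\ge 1$. *)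

(* Defs.v *)
From mathcomp Require Import all_boot.

Set Implicit Arguments.
Unset Strict Implicit.
Unset Printing Implicit Defensive.

(* A bipartite graph G = (V1 u V2, E) is given by its edge set
   E : {set V1 * V2}; its vertex set is the disjoint union V1 + V2. *)
Section Bipartite.
Variables V1 V2 : finType.
Notation vertex := (V1 + V2)%type.
Implicit Types (E B : {set V1 * V2}) (x y t v : vertex) (A C R S : {set vertex}).

Definition adj E : rel vertex := fun x y =>
  match x, y with
  | inl a, inr b => (a, b) \in E
  | inr b, inl a => (a, b) \in E
  | _, _ => false
  end.

Definition same_side x y : bool :=
  match x, y with
  | inl _, inl _ | inr _, inr _ => true
  | _, _ => false
  end.

Definition nbh E x : {set vertex} := [set y | adj E x y].

Definition nbhs E A : {set vertex} := \bigcup_(x in A) nbh E x.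

(* The equivalence relation behind twin classes; every vertex is related to
   itself, hence y != t in has_no_twin. *)
Definition twins E x y : bool := same_side x y && (nbh E x == nbh E y).

Definition twin_class_of E x : {set vertex} := [set y | twins E x y].

Definition twin_class E R : Prop := exists x, R = twin_class_of E x.

Definition has_no_twin E t : bool := [forall y, (y != t) ==> ~~ twins E t y].

Definition sisters E R : {set vertex} :=
  let S := nbhs E R in
  [set t in nbhs E S :\: R |
    has_no_twin E t && [exists v, (v \notin S) && (nbh E t == v |: S)]].

Definition bicluster E C : Prop :=
  exists (X : {set V1}) (Y : {set V2}),
    [/\ C = (inl @: X) :|: (inr @: Y),
        forall a, a \in X -> nbh E (inl a) = inr @: Y
      & forall b, b \in Y -> nbh E (inr b) = inl @: X].

Definition component E C : Prop := exists x, C = [set y | connect (adj E) x y].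

Definition bicluster_graph E : Prop := forall C, component E C -> bicluster E C.

(* A biclustering of (V1 u V2, E) is any B with bicluster_graph B: the type of
   B already imposes the same vertex set and only edges between V1 and V2. *)
Definition cost E B : nat := #|(E :\: B) :|: (B :\: E)|.

Definition min_biclustering_cost E (k : nat) : Prop :=
  (exists B, bicluster_graph B /\ cost E B = k) /\
  (forall B, bicluster_graph B -> k <= cost E B).

Definition rule1_applies E : Prop := exists C, component E C /\ bicluster E C.

Definition rule2_applies E : Prop :=
  exists R, twin_class E R /\ #|R| > #|nbhs E (nbhs E R) :\: R|.

Definition rule3_applies E : Prop :=
  exists R, twin_class E R /\
    let T := sisters E R in
    let W := nbhs E (nbhs E R) :\: (R :|: T) in
    #|R| > #|W| /\ #|T| >= 1.

End Bipartite.

(* Main.v *)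
(** Take [k / 2] disjoint copies of a 9-vertex graph of biclustering cost 2:
    the path [p0 - a0 - p1 - a1 - p2 - a2] in which every [pj] is doubled into
    a pair of twins. No [ai] has a twin, and doubling rules out sisters: every
    vertex on the second side has a twin, and neighbourhoods on the first side
    are unions of pairs, so none extends another by exactly one vertex.
    Deleting the two edges between [a1] and [p1] in each copy leaves a bicluster
    graph. Conversely, a bicluster graph has no induced [P4], and the two
    twins of each pair yield two induced copies [p0 - a0 - p1 - a1] sharing no
    vertex pair between the two sides, so each copy needs at least two edits. *)

Require Import Defs.
From mathcomp Require Import all_boot.
From mathcomp Require Import zify.

Set Implicit Arguments.
Unset Strict Implicit.
Unset Printing Implicit Defensive.

Section BiclusterGraphs.
Variables V1 V2 : finType.
Implicit Types (E B : {set V1 * V2}) (x y : V1 + V2).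

Lemma adj_sym E : symmetric (adj E).
Proof. by case=> a [] b. Qed.

Lemma in_nbh E x y : (y \in nbh E x) = adj E x y.
Proof. by rewrite inE. Qed.

Lemma nbhsP E (A : {set V1 + V2}) y :
  reflect (exists2 x, x \in A & adj E x y) (y \in nbhs E A).
Proof.
by apply: (iffP bigcupP) => -[x xA xy]; exists x; rewrite ?in_nbh // -in_nbh.
Qed.

Lemma mem_twin_class_of E x : x \in twin_class_of E x.
Proof. by rewrite inE /twins eqxx andbT; case: x. Qed.

Lemma nbhs_twin_class_of E x : nbhs E (twin_class_of E x) = nbh E x.
Proof.
apply/setP => y; apply/nbhsP/idP => [[z] | xy].
  by rewrite inE => /andP[_ /eqP ->]; rewrite in_nbh.
by exists x; rewrite ?mem_twin_class_of // -in_nbh.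
Qed.

Definition P4_free B : Prop :=
  forall a b a' b', (a, b) \in B -> (a', b) \in B -> (a', b') \in B ->
    (a, b') \in B.

Lemma mem_bicluster_inl (X : {set V1}) (Y : {set V2}) a :
  ((inl a : V1 + V2) \in (inl @: X) :|: (inr @: Y)) = (a \in X).
Proof.
rewrite inE mem_imset; last by move=> ? ? [].
by case: imsetP => [[]|] //; rewrite orbF.
Qed.

Lemma mem_bicluster_inr (X : {set V1}) (Y : {set V2}) b :
  ((inr b : V1 + V2) \in (inl @: X) :|: (inr @: Y)) = (b \in Y).
Proof.
rewrite inE orbC mem_imset; last by move=> ? ? [].
by case: imsetP => [[]|] //; rewrite orbF.
Qed.

Lemma bicluster_edge E (X : {set V1}) (Y : {set V2}) a b :
    (forall a, a \in X -> nbh E (inl a) = inr @: Y) ->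
  a \in X -> ((a, b) \in E) = (b \in Y).
Proof.
move=> XY aX; rewrite -[LHS](in_nbh E (inl a) (inr b)) XY // mem_imset //.
by move=> ? ? [].
Qed.

Lemma bicluster_edgeV E (X : {set V1}) (Y : {set V2}) a b :
    (forall b, b \in Y -> nbh E (inr b) = inl @: X) ->
  b \in Y -> ((a, b) \in E) = (a \in X).
Proof.
move=> YX bY; rewrite -[LHS](in_nbh E (inr b) (inl a)) YX // mem_imset //.
by move=> ? ? [].
Qed.

Lemma bicluster_graph_P4_free B : bicluster_graph B -> P4_free B.
Proof.
move=> bB a b a' b' ab a'b a'b'.
have [|X [Y [defC XY YX]]] := bB [set y | connect (adj B) (inl a) y].
  by exists (inl a).
have aX : a \in X by rewrite -(mem_bicluster_inl _ Y) -defC inE connect0.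
have bY : b \in Y by rewrite -(bicluster_edge _ XY aX).
have a'X : a' \in X by rewrite -(bicluster_edgeV _ YX bY).
by rewrite (bicluster_edge _ XY aX) -(bicluster_edge _ XY a'X).
Qed.

Lemma P4_free_connect B a b :
  P4_free B -> connect (adj B) (inl a) (inr b) -> (a, b) \in B.
Proof.
move=> freeB.
pose near z := match z with
  | inl a' => (a' == a) || [exists b, ((a, b) \in B) && ((a', b) \in B)]
  | inr b => (a, b) \in B end.
have nearS x y : adj B x y -> near x -> near y.
  case: x y => [a'|b'] [a''|b''] //= e.
    case/orP => [/eqP <- //|/existsP[c /andP[ac a'c]]]; exact: freeB ac a'c e.
  by move=> ab'; apply/orP; right; apply/existsP; exists b'; rewrite ab'.
have closed_near : forall p x, path (adj B) x p -> near x -> near (last x p).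
  by elim=> //= y p IHp x /andP[xy yp] nx; apply: IHp => //; apply: nearS nx.
case/connectP => p /closed_near np def_b; change (near (inr b)).
by rewrite def_b; apply: np; rewrite /= eqxx.
Qed.

Lemma P4_free_bicluster_graph B : P4_free B -> bicluster_graph B.
Proof.
move=> freeB C [x ->].
have csym : connect_sym (adj B).
  by apply: sym_connect_sym; apply: adj_sym.
exists [set a | connect (adj B) x (inl a)], [set b | connect (adj B) x (inr b)].
split.
- by apply/setP => -[a|b]; rewrite (mem_bicluster_inl, mem_bicluster_inr) !inE.
- move=> a; rewrite inE => xa; apply/setP => -[a'|b]; rewrite in_nbh.
    by apply/esym/negP => /imsetP[].
  rewrite mem_imset ?inE; last by move=> ? ? [].
  apply/idP/idP => [ab | xb]; first exact: connect_trans xa (connect1 ab).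
  by apply: P4_free_connect => //; apply: connect_trans xb; rewrite csym.
- move=> b; rewrite inE => xb.
  apply/setP => -[a|b']; rewrite in_nbh; last first.
    by apply/esym/negP => /imsetP[].
  rewrite mem_imset ?inE; last by move=> ? ? [].
  apply/idP/idP => [ab | xa]; first exact: connect_trans xb (connect1 ab).
  by apply: P4_free_connect => //; apply: connect_trans xb; rewrite csym.
Qed.

End BiclusterGraphs.

Definition zigzag (i j : 'I_3) : bool := (j == i :> nat) || (j == i.+1 :> nat).

Lemma zigzag_refl i : zigzag i i.
Proof. by rewrite /zigzag eqxx. Qed.

Lemma zigzag_anti i j : zigzag i j -> zigzag j i -> i = j.
Proof. by rewrite /zigzag => ij ji; apply: val_inj => /=; lia. Qed.

Lemma zigzag_link_row i :
  exists i' j, [/\ i' != i, zigzag i j & zigzag i' j].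
Proof.
case: i => [[|[|[|//]]] ?].
- by exists (@Ordinal 3 1 isT), (@Ordinal 3 1 isT).
- by exists (@Ordinal 3 0 isT), (@Ordinal 3 1 isT).
- by exists (@Ordinal 3 1 isT), (@Ordinal 3 2 isT).
Qed.

Lemma zigzag_link_col j :
  exists j' i, [/\ j' != j, zigzag i j & zigzag i j'].
Proof.
case: j => [[|[|[|//]]] ?].
- by exists (@Ordinal 3 1 isT), (@Ordinal 3 0 isT).
- by exists (@Ordinal 3 0 isT), (@Ordinal 3 0 isT).
- by exists (@Ordinal 3 1 isT), (@Ordinal 3 1 isT).
Qed.

Section TwinnedPaths.
Variable m : nat.

(* [(c, i)] is the vertex [ai] of copy [c]; [(c, (j, s))] with [s : bool] are
   the two twins [pj] of copy [c]. *)
Notation U1 := ('I_m * 'I_3)%type.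
Notation U2 := ('I_m * ('I_3 * bool))%type.

Definition twinned_paths : {set U1 * U2} :=
  [set e | (e.1.1 == e.2.1) && zigzag e.1.2 e.2.2.1].

Local Notation E := twinned_paths.

Lemma in_twinned_paths c i c' j s :
  (((c, i), (c', (j, s))) \in E) = (c == c') && zigzag i j.
Proof. by rewrite inE. Qed.

Lemma twinned_paths_nbhL_inj (a a' : U1) :
  nbh E (inl a) = nbh E (inl a') -> a = a'.
Proof.
case: a a' => [c i] [c' i'] /setP eqN.
have /esym := eqN (inr (c, (i, true))); have := eqN (inr (c', (i', true))).
rewrite !in_nbh /= !in_twinned_paths !eqxx !zigzag_refl /=.
move=> /andP[/eqP -> ii'] /andP[_ i'i].
by rewrite (zigzag_anti ii' i'i).
Qed.

Lemma twinned_paths_nbhR_inj (b b' : U2) :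
  nbh E (inr b) = nbh E (inr b') -> (b.1, b.2.1) = (b'.1, b'.2.1).
Proof.
case: b b' => [c [j s]] [c' [j' s']] /setP eqN /=.
have /esym := eqN (inl (c, j)); have := eqN (inl (c', j')).
rewrite !in_nbh /= !in_twinned_paths !eqxx !zigzag_refl /=.
move=> /andP[/eqP -> j'j] /andP[_ jj'].
by rewrite (zigzag_anti jj' j'j).
Qed.

Lemma twinned_paths_nbhR_flip c j s s' :
  nbh E (inr (c, (j, s))) = nbh E (inr (c, (j, s'))).
Proof.
by apply/setP => -[[c' i]|b]; rewrite !in_nbh //= !in_twinned_paths.
Qed.

Lemma twinned_paths_rule1 : ~ rule1_applies E.
Proof.
case=> C [[x defC] [X [Y [defXY XY YX]]]].
have xC : x \in C by rewrite defC inE connect0.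
have noX a : a \notin X.
  apply/negP => aX; case: a aX => [c i] aX.
  have [i' [j [ne_i' ij i'j]]] := zigzag_link_row i.
  have bY : (c, (j, true)) \in Y.
    by rewrite -(bicluster_edge _ XY aX) in_twinned_paths eqxx.
  have a'X : (c, i') \in X.
    by rewrite -(bicluster_edgeV _ YX bY) in_twinned_paths eqxx.
  have [ei] : (c, i') = (c, i) by apply: twinned_paths_nbhL_inj; rewrite !XY.
  by rewrite ei eqxx in ne_i'.
case: x {defC} xC => [a|[c [j s]]]; rewrite defXY.
  by rewrite mem_bicluster_inl; apply/negP.
rewrite mem_bicluster_inr => bY; move: (noX (c, j)).
by rewrite -(bicluster_edgeV _ YX bY) in_twinned_paths eqxx zigzag_refl.
Qed.

Lemma twinned_paths_rule2 : ~ rule2_applies E.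
Proof.
case=> R [[x ->]]; rewrite nbhs_twin_class_of; apply/negP; rewrite -leqNgt.
case: x => [[c i] | [c [j s]]].
  have [i' [j [ne_i' ij i'j]]] := zigzag_link_row i.
  apply: (@leq_trans #|[set inl (c, i) : U1 + U2]|).
    apply: subset_leq_card.
    apply/subsetP => -[a|b]; rewrite !inE => /andP[] // _ /eqP.
    by move/twinned_paths_nbhL_inj ->.
  rewrite cards1 card_gt0; apply/set0Pn; exists (inl (c, i')).
  rewrite inE; apply/andP; split; last first.
    by apply/nbhsP; exists (inr (c, (j, true)));
      rewrite ?in_nbh /= in_twinned_paths eqxx.
  rewrite inE; apply: contra ne_i' => /andP[_ /eqP].
  by move/twinned_paths_nbhL_inj => [->].
have [j' [i [ne_j' ij ij']]] := zigzag_link_col j.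
pose pair j : {set U1 + U2} := [set inr (c, (j, s)) | s : bool].
have card_pairE l l' : #|pair l| = #|pair l'|.
  by rewrite !card_imset // => ? ? [].
apply: (@leq_trans #|pair j|).
  apply: subset_leq_card.
  apply/subsetP => -[a|[c' [l t]]]; rewrite inE => /andP[] // _ /eqP.
  by move/twinned_paths_nbhR_inj => [<- <-]; apply: imset_f.
rewrite (card_pairE j j'); apply: subset_leq_card.
apply/subsetP => _ /imsetP[t _ ->]; rewrite inE; apply/andP; split; last first.
  by apply/nbhsP; exists (inl (c, i)); rewrite ?in_nbh /= in_twinned_paths eqxx.
rewrite inE; apply: contra ne_j' => /andP[_ /eqP].
by move/twinned_paths_nbhR_inj => [->].
Qed.

Lemma twinned_paths_sisters x : sisters E (twin_class_of E x) = set0.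
Proof.
apply/setP => t; rewrite [RHS]inE; apply/negP; rewrite inE nbhs_twin_class_of.
case/and3P => _ /forallP no_twin /existsP[v /andP[vNx /eqP Nt]].
case: t no_twin Nt => [a _ | [c [j s]] no_twin _]; last first.
  move: (no_twin (inr (c, (j, ~~ s)))).
  rewrite /twins /= (twinned_paths_nbhR_flip _ _ s (~~ s)) eqxx implybF.
  by case/negPn/eqP; case: s {no_twin}.
move=> Nt.
have : v \in nbh E (inl a) by rewrite Nt setU11.
case: v vNx Nt => [a'|[c [j s]]] vNx Nt; rewrite in_nbh // => va.
have : inr (c, (j, ~~ s)) \in nbh E (inl a).
  move: va; rewrite in_nbh /=; case: a {Nt} => ? ?.
  by rewrite !in_twinned_paths.
rewrite Nt inE => /orP[|]; first by rewrite inE => /eqP[]; case: s {Nt va vNx}.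
move: vNx; rewrite !in_nbh; case: x {Nt} => [[c' i]|b] //=.
by rewrite !in_twinned_paths => /negP.
Qed.

Lemma twinned_paths_rule3 : ~ rule3_applies E.
Proof. by case=> R [[x ->]] /= []; rewrite twinned_paths_sisters cards0. Qed.

Definition split_paths : {set U1 * U2} :=
  [set e : U1 * U2 | (e.1.1 == e.2.1) && ((0 < e.1.2) == (1 < e.2.2.1))].

Lemma split_paths_bicluster_graph : bicluster_graph split_paths.
Proof.
apply: P4_free_bicluster_graph => a b a' b'; rewrite !inE.
move=> /andP[/eqP-> /eqP->] /andP[/eqP<- /eqP<-] /andP[/eqP-> /eqP->].
by rewrite !eqxx.
Qed.

Lemma cost_split_paths : cost E split_paths = m.*2.
Proof.
pose f (d : 'I_m * bool) : U1 * U2 :=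
  ((d.1, @Ordinal 3 1 isT), (d.1, (@Ordinal 3 1 isT, d.2))).
have -> : m.*2 = #|f @: [set: 'I_m * bool]|.
  rewrite card_imset => [|[c s] [c' s'] [-> _ ->] //].
  by rewrite cardsT card_prod card_ord card_bool muln2.
congr #|pred_of_set _|; apply/setP => -[[c i] [c' [j s]]]; rewrite !inE /=.
apply/idP/imsetP => [|[[d t] _ [-> -> -> -> _]]]; last by rewrite eqxx.
have [<- diff|//] := eqVneq c c'.
have [-> ->] : i = @Ordinal 3 1 isT /\ j = @Ordinal 3 1 isT.
  case: i j diff => [[|[|[|//]]] ?] [[|[|[|//]]] ?] // _.
  by split; apply: val_inj.
by exists (c, s); rewrite ?inE.
Qed.

Lemma twinned_paths_cost_ge B : bicluster_graph B -> m.*2 <= cost E B.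
Proof.
move=> /bicluster_graph_P4_free freeB; rewrite /cost; set D := _ :|: _.
pose f (e : U1 * U2) : 'I_m * bool := (e.2.1, e.2.2.2).
have -> : m.*2 = #|[set: 'I_m * bool]|.
  by rewrite cardsT card_prod card_ord card_bool muln2.
apply: leq_trans (leq_imset_card f D); apply: subset_leq_card.
apply/subsetP => -[c s] _; apply/imsetP.
pose o0 := @Ordinal 3 0 isT; pose o1 := @Ordinal 3 1 isT.
pose e i j : U1 * U2 := ((c, i), (c, (j, s))).
case: (boolP [exists i, exists j, e i j \in D]) => [|noD].
  by case/existsP=> i /existsP[j eD]; exists (e i j).
have agree i j : (e i j \in B) = zigzag i j.
  have : e i j \notin D.
    apply: contra noD => eD.
    by apply/existsP; exists i; apply/existsP; exists j.
  by rewrite !inE /= eqxx /=; case: (_ \in B); case: zigzag.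
have := agree o1 o0; rewrite (_ : e o1 o0 \in B) //.
by apply: (freeB _ (c, (o1, s)) (c, o0)); rewrite -/(e _ _) agree.
Qed.

End TwinnedPaths.

Theorem theorem2 (k : nat) (k_even : ~~ odd k) (k_ge2 : 2 <= k) :
  exists (V1 V2 : finType) (E : {set V1 * V2}),
    [/\ 2 * #|{: V1 + V2}| = 9 * k,
        ~ rule1_applies E,
        ~ rule2_applies E,
        ~ rule3_applies E
      & min_biclustering_cost E k].
Proof.
have def_k : k./2.*2 = k by rewrite even_halfK.
do 2!eexists; exists (twinned_paths k./2); split.
- by rewrite card_sum !card_prod !card_ord card_bool; lia.
- exact: twinned_paths_rule1.
- exact: twinned_paths_rule2.
- exact: twinned_paths_rule3.
- rewrite -[in X in min_biclustering_cost _ X]def_k; split.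
    exists (split_paths k./2).
    split; first exact: split_paths_bicluster_graph.
    exact: cost_split_paths.
  exact: twinned_paths_cost_ge.
Qed.
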